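(* Let $X$ be a ($T_1$) topological space. Then (1) $\mathrm{cs}^*_\chi(X)\le\mathrm{cs}_\chi(X)\le\mathrm{sb}_\chi(X)\le\chi(X)$; (2) $\chi(X)=\mathrm{sb}_\chi(X)$ if $X$ is Fréchet–Urysohn; (3) the following are equivalent: $\mathrm{cs}^*_\chi(X)<\aleph_0$; $\mathrm{cs}_\chi(X)<\aleph_0$; $\mathrm{sb}_\chi(X)<\aleph_0$; $\mathrm{cs}^*_\chi(X)=1$; $\mathrm{cs}_\chi(X)=1$; $\mathrm{sb}_\chi(X)=1$; each convergent sequence in $X$ is trivial (i.e. eventually constant); (4) $\mathrm{sb}_\chi(X)\le 2^{\mathrm{cs}^*_\chi(X)}$; (5) $\mathrm{cs}_\chi(X)\le\mathrm{cs}^*_\chi(X)\cdot\sup\{|[\kappa]^{\le\omega}|:\kappa<\mathrm{cs}^*_\chi(X)\}\le(\mathrm{cs}^*_\chi(X))^{\aleph_0}$, where $\kappa$ ranges over cardinals and $[\kappa]^{\le\omega}=\{A\subset\kappa:|A|\le\aleph_0\}$.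
   Context: All topological spaces are assumed to be $T_1$. A family $\mathcal N$ of subsets of $X$ is a $\mathrm{cs}$-network (resp. $\mathrm{cs}^*$-network) at $x\in X$ if for every neighborhood $U$ of $x$ and every sequence $(x_n)\subset X$ convergent to $x$ there is $N\in\mathcal N$ with $N\subset U$ such that $x_n\in N$ for all but finitely many (resp. for infinitely many) $n$. A set $B\subset X$ is a sequential barrier at $x$ if every sequence in $X$ convergent to $x$ has all but finitely many terms in $B$. An $\mathrm{sb}$-network at $x$ is a family $\mathcal N$ of sequential barriers at $x$ such that for every neighborhood $U$ of $x$ there is $N\in\mathcal N$ with $x\in N\subset U$. $\mathrm{cs}^*_\chi(X)$ (resp. $\mathrm{cs}_\chi(X)$, $\mathrm{sb}_\chi(X)$) is the supremum over $x\in X$ of the smallest size of a $\mathrm{cs}^*$-network (resp. $\mathrm{cs}$-network, $\mathrm{sb}$-network) at $x$; for $X=\emptyset$ these are set equal to $1$. $\chi(X)$ is the character of $X$ (supremum over points of the smallest size of a neighborhood base), with $\chi(\emptyset)=1$ by convention. $X$ is Fréchet–Urysohn if whenever $a\in X$ is a cluster point of $A\subset X$ there is a sequence in $A$ convergent to $a$. *)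

(* Defs.v *)
From mathcomp Require Import all_boot all_order.
From mathcomp Require Import all_classical.
From mathcomp Require Import topology.

Set Implicit Arguments.
Unset Strict Implicit.
Unset Printing Implicit Defensive.

Local Open Scope classical_set_scope.
Local Open Scope card_scope.

(* Cardinals are represented by sets, compared with #<= and #=, and only their *)
(* cardinality is meaningful.                                                  *)

Definition card_lt {T U : Type} (A : set T) (B : set U) : Prop :=
  A #<= B /\ ~ (B #<= A).

(* An element of P of smallest cardinality. *)
Definition card_least {T : Type} (P : set (set T)) : set T :=
  xget set0 [set A | P A /\ forall B, P B -> A #<= B].

Lemma card_leastP {T : Type} (P : set (set T)) : P !=set0 ->
  P (card_least P) /\ forall B, P B -> card_least P #<= B.
Proof.
move=> [A0 PA0].
suff [A HA] : [set A | P A /\ forall B, P B -> A #<= B] !=set0.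
  by rewrite /card_least; case: xgetP => [B _ HB|/(_ A)].
pose I := {A : set T | P A}.
pose good (G : set (I -> T)) :=
  (forall f, G f -> forall i, sval i (f i)) /\
  (forall f g, G f -> G g -> forall i, f i = g i -> f = g).
have [F FG Ftot|G [[Gin Ginj] Gmax]] := @Zorn_bigcup _ [set G | good G].
  split=> [f [H FH Hf] i|f g [H FH Hf] [K FK Kg] i fg].
    by have [+ _] := FG _ FH; apply.
  have [HK|KH] := Ftot _ _ FH FK.
    by have [_ Kinj] := FG _ FK; exact: (Kinj _ _ (HK _ Hf) Kg i).
  by have [_ Hinj] := FG _ FH; exact: (Hinj _ _ Hf (KH _ Kg) i).
have inj i : {in G &, injective (fun f : I -> T => f i)}.
  by move=> f g /set_mem Gf /set_mem Gg; exact: Ginj.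
have [i Hi] : exists i : I, sval i `<=` [set f i | f in G].
  apply: contrapT => /forallNP nex.
  have /choice[g Hg] : forall i : I, exists t, sval i t /\ ~ [set f i | f in G] t.
    move=> i; have /existsNP[t /not_implyP[]] := nex i.
    by exists t.
  have gG i f : G f -> f i <> g i.
    by move=> Gf fg; have [_] := Hg i; apply; exists f.
  apply: (Gmax (G `|` [set g])); last first.
    split=> [f [Gf|->] i|f h [Gf|->] [Gh|->] i fh //].
    - exact: Gin.
    - by have [] := Hg i.
    - exact: Ginj fh.
    - by have := gG i _ Gf; rewrite fh.
    - by have := gG i _ Gh; rewrite -fh.
  split; first by move=> f Gf; left.
  move=> /(_ g (or_intror erefl)) Gg.
  by have := gG (exist _ A0 PA0) _ Gg.
exists (sval i); split=> [|B PB]; first exact: (svalP i).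
apply: card_le_trans (subset_card_le Hi) _.
apply: card_le_trans (card_image_le _ _) _.
pose j : I := exist _ B PB.
apply: (@card_le_trans _ _ _ [set f j | f in G]).
  by have := inj_card_eq (inj j); rewrite card_eq_le => /andP[].
by apply: subset_card_le => _ [f Gf <-]; exact: (Gin f Gf j).
Qed.

(* The least upper bound of the cardinals of the F i, for i in D. It is at most *)
(* the cardinal of T, hence minimizing over the subsets of T is no restriction. *)
Definition card_sup {T I : Type} (D : set I) (F : I -> set T) : set T :=
  card_least [set S | forall i, D i -> F i #<= S].

Lemma card_supP {T I : Type} (D : set I) (F : I -> set T) :
  (forall i, D i -> F i #<= card_sup D F) /\
  (forall S : set T, (forall i, D i -> F i #<= S) -> card_sup D F #<= S).
Proof. by apply: card_leastP; exists setT => i _; exact: card_leT. Qed.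

Definition countable_subsets {T : Type} (A : set T) : set (set T) :=
  [set B | B `<=` A /\ countable B].

(* The supremum of |[kappa]^{<= omega}| over the cardinals kappa < |K|; each of *)
(* these cardinals is the cardinal of a subset of T.                            *)
Definition sup_countable_subsets {T : Type} (K : set T) : set (set T) :=
  card_sup [set A : set T | card_lt A K] countable_subsets.

Definition subsets_of {T : Type} (K : set T) : set (set T) :=
  [set A | A `<=` K].

Definition sequences_in {T : Type} (K : set T) : set (nat -> T) :=
  [set f | forall n, K (f n)].

Section local_networks.
Context {X : topologicalType}.
Implicit Types (x : X) (N : set (set X)) (B : set X) (u : nat -> X).

Definition cs_network x N : Prop :=
  forall (U : set X) u, nbhs x U -> u @ \oo --> x ->
    exists2 A, N A & A `<=` U /\ \forall n \near \oo, A (u n).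

Definition cs_star_network x N : Prop :=
  forall (U : set X) u, nbhs x U -> u @ \oo --> x ->
    exists2 A, N A & A `<=` U /\ infinite_set [set n | A (u n)].

Definition sequential_barrier x B : Prop :=
  forall u, u @ \oo --> x -> \forall n \near \oo, B (u n).

Definition sb_network x N : Prop :=
  (forall B, N B -> sequential_barrier x B) /\
  (forall U : set X, nbhs x U -> exists2 B, N B & B x /\ B `<=` U).

Definition nbhs_base x N : Prop :=
  (forall B, N B -> nbhs x B) /\
  (forall U : set X, nbhs x U -> exists2 B, N B & B `<=` U).

End local_networks.

(* The supremum over x of the smallest size of a family N with P x N, and 1 if *)
(* X is empty. Such N exist at every x for the four choices of P used below.   *)
Definition sup_least_size (X : topologicalType)
    (P : X -> set (set X) -> Prop) : set (set X) :=
  if `[< [set: X] = set0 >] then [set set0]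
  else card_sup [set: X] (fun x => card_least (P x)).

Definition cs_star_chi (X : topologicalType) : set (set X) :=
  sup_least_size (@cs_star_network X).

Definition cs_chi (X : topologicalType) : set (set X) :=
  sup_least_size (@cs_network X).

Definition sb_chi (X : topologicalType) : set (set X) :=
  sup_least_size (@sb_network X).

Definition character (X : topologicalType) : set (set X) :=
  sup_least_size (@nbhs_base X).

Definition frechet_urysohn (X : topologicalType) : Prop :=
  forall (A : set X) (a : X), limit_point A a ->
    exists2 u : nat -> X, (forall n, A (u n)) & u @ \oo --> a.

Definition convergent_sequences_trivial (X : topologicalType) : Prop :=
  forall (u : nat -> X) (x : X), u @ \oo --> x ->
    exists c : X, \forall n \near \oo, u n = c.

Arguments cs_star_chi X : clear implicits.
Arguments cs_chi X : clear implicits.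
Arguments sb_chi X : clear implicits.
Arguments character X : clear implicits.

(* Main.v *)
(* Passing to subsequences, if N is a cs*-network at x and U a neighborhood of *)
(* x, then the union of the members of N inside U is a sequential barrier at x, *)
(* which gives (4). For (5), well-order an infinite cs*-network so that its     *)
(* initial segments are smaller than cs*_chi. For a sequence u converging to x, *)
(* the members inside U of some initial segment already cover almost all of u:  *)
(* otherwise, the countably many indices of members covering the terms of u are *)
(* cofinal, and a diagonal subsequence of u meets every member inside U only    *)
(* finitely often. Hence the unions of countable subfamilies of initial         *)
(* segments form a cs-network. For (3), a finite cs*-network at x admits no     *)
(* nontrivial sequence: by T1, x has a neighborhood missing a chosen point      *)
(* distinct from x in each member that has one.                                 *)
Require Import Defs.
From mathcomp Require Import all_boot all_order.
From mathcomp Require Import all_classical.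
From mathcomp Require Import topology.

Local Open Scope classical_set_scope.
Local Open Scope card_scope.

(** A neighborhood base is an sb-network, an sb-network is a cs-network, and a cs-network is a
    cs*-network, which gives (1). In a Frechet-Urysohn space the barriers of an sb-network are
    neighborhoods ([frechet_urysohn_nbhs_base]), which gives (2). In (3), a finite [cs_star_chi X]
    makes convergent sequences trivial ([finite_cs_star_network_trivial]), and then each singleton
    [[set x]] is a barrier, so [sb_chi X] is 1. For (4), the barriers of
    [cs_star_network_sb_network] are at most as many as the subfamilies of [N]. For (5), each member
    of the cs-network of [cs_network_initial_segments] comes from an index and a countable subset of
    the segment below it, and [initial_well_order] keeps these segments small; enumerating countable
    subsets ([countable_subsets_le]) gives the bound by sequences. *)

(** * Comparison of cardinals and initial segments *)

Lemma card_le_injfun {T U : Type} {A : set T} {B : set U} (f : T -> U) :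
  (forall a, A a -> B (f a)) ->
  (forall a a', A a -> A a' -> f a = f a' -> a = a') -> A #<= B.
Proof.
move=> AB finj; have/injfunPex[g] : exists2 f : T -> U, set_fun A B f & set_inj A f.
  by exists f => // a a' /set_mem Aa /set_mem Aa'; exact: finj.
exact: inj_card_le g.
Qed.

Lemma card_le_exists_inj {T U : Type} {A : set T} {B : set U} (b0 : U) :
  A #<= B -> exists2 f : T -> U, (forall a, A a -> B (f a)) &
    (forall a a', A a -> A a' -> f a = f a' -> a = a').
Proof.
move=> /card_leP[f].
exists (fun a => if pselect (A a) is left Aa then val (f (SigSub (mem_set Aa))) else b0).
  by move=> a Aa; case: pselect => // Aa'; exact: set_valP.
move=> a a' Aa Aa'; case: pselect => // ?; case: pselect => // ? /val_inj E.
by have [] := inj (in_setT _) (in_setT _) E.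
Qed.

Lemma card_le_exists_surj {T U : Type} {A : set T} {B : set U} :
  A !=set0 -> A #<= B -> exists g : U -> T, g @` B = A.
Proof.
move=> [a0 Aa0] AB; have [b0|noU] := pselect (exists b : U, True); last first.
  have B0 : B = set0 by apply/seteqP; split=> b // _; apply: noU; exists b.
  by move: AB; rewrite B0 => /card_le0P A0; rewrite A0 in Aa0.
have [f fB finj] := card_le_exists_inj (projT1 (cid b0)) AB.
have /choice[g gP] : forall b, exists a, A a /\ forall a', A a' -> f a' = b -> a = a'.
  move=> b; have [[a [Aa <-]]|nb] := pselect (exists a, A a /\ f a = b).
    by exists a; split=> // a' Aa' /esym; exact: finj.
  by exists a0; split=> // a' Aa' fa'; case: nb; exists a'.
exists g; apply/seteqP; split=> [_ [b _ <-]|a Aa]; first exact: (gP b).1.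
by exists (f a); [exact: fB|exact: (gP (f a)).2].
Qed.

Lemma card_le_total {T U : Type} (A : set T) (B : set U) : A #<= B \/ B #<= A.
Proof.
(* The two sets are compared through the least cardinal of their copies in T + U. *)
have inlA : @inl T U @` A #= A by apply: inj_card_eq => x y _ _ [].
have inrB : @inr T U @` B #= B by apply: inj_card_eq => x y _ _ [].
pose P : set (set (T + U)) := [set inl @` A; inr @` B].
have [PC leC] : P (card_least P) /\ forall C, P C -> card_least P #<= C.
  by apply: card_leastP; exists (inl @` A); left.
case: PC => CE; [left|right].
  by rewrite -(card_le_eql inlA) -(card_le_eqr inrB) -CE; apply: leC; right.
by rewrite -(card_le_eql inrB) -(card_le_eqr inlA) -CE; apply: leC; left.
Qed.

(** By definition [card_sup] is least only among subsets of [T]. A bound [S] from another type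
    either has a copy inside [T] or is at least as large as all of [T]. *)
Lemma card_sup_le {T I U : Type} (D : set I) (F : I -> set T) (S : set U) :
  (forall i, D i -> F i #<= S) -> card_sup D F #<= S.
Proof.
move=> FS; have [ST|TS] := card_le_total S [set: T]; last first.
  exact: card_le_trans (card_leT _) TS.
have /card_subP[S' S'S _] := ST; rewrite -(card_le_eqr S'S).
apply: (card_supP D F).2 => i Di; rewrite (card_le_eqr S'S); exact: FS.
Qed.

Lemma card_le1 {T : Type} {A : set T} :
  A !=set0 -> A #<= `I_1 -> A #= `I_1.
Proof.
move=> [a Aa] A1; apply: Cantor_Bernstein A1 _.
by rewrite -(card_le_eql (card_set1 (x := a))); apply: subset_card_le => _ ->.
Qed.

Lemma card_le_nonempty {T U : Type} {A : set T} {B : set U} :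
  A #<= B -> A !=set0 -> B !=set0.
Proof.
move=> AB A0; apply: contrapT => /nonemptyPn B0.
by move: AB A0; rewrite B0 => /card_le0P -> [].
Qed.

(** Hilbert's hotel: along a sequence [f] in the rest of [A], [a] moves to [f 0] and each [f n] to
    [f n.+1]. *)
Lemma card_leD1 {T : Type} {A : set T} (a : T) :
  infinite_set A -> A #<= A `\ a.
Proof.
move=> Ainf.
have /infiniteP/(card_le_exists_inj a)[f fA finj] : infinite_set (A `\ a).
  exact: infinite_setD.
pose ran := [set f n | n in [set: nat]].
have /choice[g gP] : forall b, exists n, ran b -> f n = b.
  move=> b; have [[n _ fn]|nb] := pselect (ran b); last by exists 0.
  by exists n.
have fI m n : f m = f n -> m = n by exact: finj.
have gf n : g (f n) = n by apply: fI; apply: gP; exists n.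
pose h b := if pselect (b = a) is left _ then f 0
  else if pselect (ran b) is left _ then f (g b).+1 else b.
apply: (card_le_injfun h) => [b Ab|b c Ab Ac].
  rewrite /h; case: pselect => [_|ba]; first exact: fA.
  by case: pselect => // _; exact: fA.
rewrite /h; case: (pselect (b = a)) => [->|ba];
  case: (pselect (c = a)) => [->|ca] //.
- by case: pselect => [_ /fI //|nc E]; case: nc; exists 0.
- by case: pselect => [_ /fI //|nb E]; case: nb; exists 0.
- case: (pselect (ran b)) => [rb|nb]; case: (pselect (ran c)) => [rc|nc] //.
  + by move=> /fI [gbc]; rewrite -(gP _ rb) -(gP _ rc) gbc.
  + by move=> E; case: nc; exists (g b).+1.
  + by move=> E; case: nb; exists (g c).+1.
Qed.

(* I is K itself, or else the first initial segment of K equipotent with K. *)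
Lemma initial_well_order {T : Type} {K : set T} : infinite_set K ->
  exists (I : set T) (R : T -> T -> Prop),
    [/\ I #= K,
        forall a b, R a b \/ R b a,
        forall a b c, R a b -> R b c -> R a c &
        forall a, I a -> card_lt [set b | I b /\ R b a] K].
Proof.
move=> Kinf; have [R Rwo] := @wochoice.well_ordering_principle {classic T}.
have minR (A : set T) : A !=set0 -> exists2 a, A a & forall b, A b -> R a b.
  move=> [a Aa]; have [|z [[zA zmin] _]] := Rwo [pred x | `[< A x >]].
    by exists a; exact/asboolP.
  by exists z => [|b Ab]; [exact/asboolP|apply/zmin/asboolP].
have Rtot a b : R a b \/ R b a.
  have [|c] := minR [set a; b]; first by exists a; left.
  by case=> -> cmin; [left|right]; apply: cmin; [right|left].
(* Antisymmetry is the uniqueness of the least element of the pair. *)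
have Ranti a b : R a b -> R b a -> a = b.
  move=> Rab Rba; have [|z [_ zuniq]] := Rwo [pred x | `[< [set a; b] x >]].
    by exists a; apply/asboolP; left.
  have Rxx c : R c c by case: (Rtot c c).
  have <- : z = a by apply: zuniq; split; [apply/asboolP; left|move=> c /asboolP[]->].
  by apply: zuniq; split; [apply/asboolP; right|move=> c /asboolP[]->].
have Rtrans a b c : R a b -> R b c -> R a c.
  move=> Rab Rbc; have [|d] := minR [set a; b; c]; first by exists a; left; left.
  case=> [[|]|] -> dmin.
  - by apply: dmin; right.
  - by rewrite (Ranti a b)//; apply: dmin; left; left.
  - by rewrite -(Ranti b c)//; apply: dmin; left; right.
pose seg a := [set b | [/\ K b, R b a & b <> a]].
have [I [IK Icard]] : exists I : set T, I #= K /\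
    forall a, I a -> ~ (K #<= [set b | [/\ I b, R b a & b <> a]]).
  (* If some strict segment is as large as [K], the first such one is taken; its own strict segments
     are then smaller. *)
  have [[a0 Ba0]|nobad] := pselect ([set a | K a /\ K #<= seg a] !=set0).
    have [|a [Ka Ksega] amin] := minR [set a | K a /\ K #<= seg a]; first by exists a0.
    exists (seg a); split.
      by apply: Cantor_Bernstein Ksega; apply: subset_card_le => b [].
    move=> b [Kb Rba ba] Kle; apply: (ba); apply: (Ranti) => //; apply: amin.
    split=> //; apply: card_le_trans Kle _.
    by apply: subset_card_le => c [[? _ _] ? ?]; split.
  by exists K; split=> // a Ka Kle; apply: nobad; exists a.
exists I, R; split=> // a Ia; split.
  by rewrite -(card_le_eqr IK); apply: subset_card_le => b [].
move=> Kle; apply: (Icard a Ia); apply: card_le_trans (Kle) _.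
(* The choice of [I] controls strict segments; removing [a] from an infinite segment does not shrink
   it. *)
have Sinf : infinite_set [set b | I b /\ R b a].
  by move=> /(card_le_finite Kle).
apply: card_le_trans (card_leD1 a Sinf) _.
by apply: subset_card_le => b [[Ib Rba] ba].
Qed.

(** * Convergent sequences and local networks *)

Lemma not_near_infty_frequently {P : set nat} :
  ~ (\forall n \near \oo, P n) -> forall m, exists2 n, (m <= n)%N & ~ P n.
Proof.
move=> nP m; apply: contrapT => /forall2NP nex; apply: nP.
by exists m => // n /= mn; have [//|/contrapT] := nex n.
Qed.

Lemma infinite_set_unbounded {S : set nat} :
  infinite_set S -> forall m, exists2 n, (m <= n)%N & S n.
Proof.
move=> Sinf m; apply: contrapT => /forall2NP nex; apply: Sinf.
apply: sub_finite_set (finite_II m) => n Sn /=.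
by rewrite ltnNge; apply/negP => mn; case: (nex n).
Qed.

Lemma near_infty_infinite {S : set nat} : (\forall n \near \oo, S n) -> infinite_set S.
Proof.
move=> [m _ Sm] Sfin; have : finite_set (S `|` `I_m).
  by rewrite finite_setU; split=> //; exact: finite_II.
move=> fin; apply: infinite_nat; apply: sub_finite_set fin => n _.
by have [mn|nm] := leqP m n; [left; apply: Sm|right].
Qed.

Section networks.
Context {X : topologicalType}.
Implicit Types (x : X) (N : set (set X)) (B U : set X) (u : nat -> X).

Lemma cvg_subseq {u} {x} {k : nat -> nat} :
  (forall n, (n <= k n)%N) -> u @ \oo --> x -> (u \o k) @ \oo --> x.
Proof.
move=> kn ux U /ux [m _ mU]; exists m => // n /= mn; apply: mU.
exact: leq_trans mn (kn n).
Qed.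

Lemma sequential_barrier_mem {x} {B} : sequential_barrier x B -> B x.
Proof. by move=> /(_ (fun=> x) (cvg_cst _))[m _ mB]; exact: (mB m (leqnn m)). Qed.

Lemma nbhs_base_sb_network {x} {N} : nbhs_base x N -> sb_network x N.
Proof.
move=> [Nx xN]; split=> [B /Nx xB u ux|U /xN[B NB BU]]; first exact: ux.
by exists B => //; split=> //; exact: nbhs_singleton (Nx _ NB).
Qed.

Lemma sb_network_cs_network {x} {N} : sb_network x N -> cs_network x N.
Proof. by move=> [Nb xN] U u /xN[B NB [_ BU]] ux; exists B; [|split=> //; apply: Nb ux]. Qed.

Lemma cs_network_cs_star_network {x} {N} : cs_network x N -> cs_star_network x N.
Proof.
move=> Nx U u xU ux; have [B NB [BU Bu]] := Nx U u xU ux.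
by exists B => //; split=> //; exact: near_infty_infinite.
Qed.

Lemma nbhs_base_nbhs x : nbhs_base x (nbhs x).
Proof. by split=> // U xU; exists U. Qed.

Lemma cs_star_network_neq0 {x} {N} : cs_star_network x N -> N !=set0.
Proof.
by move=> /(_ setT (fun=> x) filterT (cvg_cst _))[B NB _]; exists B.
Qed.

(** If a barrier [B] were not a neighborhood of [x], some sequence outside [B] would converge to
    [x], yet it would have to enter [B]. *)
Lemma frechet_urysohn_nbhs_base {x} {N} :
  frechet_urysohn X -> sb_network x N -> nbhs_base x N.
Proof.
move=> fu [Nb xN]; split=> [B NB|U /xN[B NB [_ BU]]]; last by exists B.
apply: contrapT => nB; have [|u uB ux] := fu (~` B) x.
  move=> U xU; have [y [Uy nBy]] : exists y, U y /\ ~ B y.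
    apply: contrapT => nex; apply: nB; apply: filterS xU => y Uy.
    by apply: contrapT => nBy; apply: nex; exists y.
  exists y; split=> //; apply/eqP => yx; apply: nBy; rewrite yx.
  exact: sequential_barrier_mem (Nb _ NB).
have [m _ /(_ m (leqnn m))] := Nb _ NB _ ux; exact: uB.
Qed.

Lemma finite_cs_star_network_trivial {x} {N} {u} : accessible_space X ->
  finite_set N -> cs_star_network x N -> u @ \oo --> x ->
  \forall n \near \oo, u n = x.
Proof.
move=> T1 Nfin Nx ux; apply: contrapT => /not_near_infty_frequently freq.
have /choice[k kP] : forall m, exists n, (m <= n)%N /\ u n <> x.
  by move=> m; have [n mn unx] := freq m; exists n.
(* [y] picks a point other than [x] in each member having one; the finite set [F] of these points is
   closed by T1. *)
have /choice[y yP] : forall A : set X, exists z, (A `<=` [set x]) \/ (A z /\ z <> x).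
  move=> A; have [Ax|/existsNP[z /not_implyP[Az zx]]] := pselect (A `<=` [set x]).
    by exists x; left.
  by exists z; right.
pose F := [set y A | A in [set A | N A /\ ~ (A `<=` [set x])]].
have Fclosed : closed F.
  apply: (accessible_finite_set_closed.1 T1); apply: finite_image.
  by apply: sub_finite_set Nfin => A [].
have xF : nbhs x (~` F).
  apply: open_nbhs_nbhs; split; first exact: closed_openC.
  by move=> [A [NA nA] yA]; case: (yP A) => // -[].
have vx : (u \o k) @ \oo --> x by apply: cvg_subseq ux => n; exact: (kP n).1.
have [A NA [AF Ainf]] := Nx _ _ xF vx.
have [n _ Avn] := infinite_set_unbounded Ainf 0.
have nA : ~ (A `<=` [set x]) by move=> /(_ _ Avn); exact: (kP n).2.
have [//|[AyA _]] := yP A.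
by apply: (AF _ AyA); exists A.
Qed.

(** The eventual value [c] of a sequence converging to [x] is [x] itself: otherwise T1 makes the
    complement of [c] a neighborhood of [x]. *)
Lemma trivial_sb_network x : accessible_space X ->
  convergent_sequences_trivial X -> sb_network x [set [set x]].
Proof.
move=> T1 triv; split=> [_ -> u ux|U xU]; last first.
  exists [set x] => //; split=> // _ ->; exact: nbhs_singleton.
have [c [m _ uc]] := triv _ _ ux; exists m => // n /= mn.
rewrite (uc _ mn); apply: contrapT => /eqP cx.
have : nbhs x (~` [set c]).
  apply: open_nbhs_nbhs; split=> [|/= xc].
    exact/closed_openC/accessible_closed_set1.
  by rewrite xc eqxx in cx.
move=> /ux[p _ pP]; apply: (pP (maxn m p) (leq_maxr m p)) => /=.
exact: uc (leq_maxl m p).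
Qed.

Lemma cs_star_network_sb_network {x} {N} : cs_star_network x N ->
  sb_network x [set \bigcup_(A in [set A | N A /\ A `<=` U]) A | U in nbhs x].
Proof.
move=> Nx; have bar U : nbhs x U ->
    sequential_barrier x (\bigcup_(A in [set A | N A /\ A `<=` U]) A).
  move=> xU u ux; apply: contrapT => /not_near_infty_frequently freq.
  have /choice[k kP] : forall m, exists n, (m <= n)%N /\
      ~ (\bigcup_(A in [set A | N A /\ A `<=` U]) A) (u n).
    by move=> m; have [n mn un] := freq m; exists n.
  have vx : (u \o k) @ \oo --> x by apply: cvg_subseq ux => n; exact: (kP n).1.
  have [A NA [AU Ainf]] := Nx _ _ xU vx.
  have [n _ Avn] := infinite_set_unbounded Ainf 0.
  by apply: (kP n).2; exists A.
split=> [_ [U xU <-]|U xU]; first exact: bar.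
eexists; [by exists U|split; first exact: sequential_barrier_mem (bar _ xU)].
by move=> y [A [_ AU] Ay]; exact: AU.
Qed.

End networks.

(** * Suprema of least sizes *)

Lemma least_size_le_sup {X : topologicalType} {P : X -> set (set X) -> Prop} (x : X) :
  (exists N, P x N) -> exists2 N, P x N & N #<= sup_least_size P.
Proof.
move=> /card_leastP[Px _]; exists (card_least (P x)) => //.
rewrite /sup_least_size; case: asboolP => [X0|_].
  by have : [set: X] x by []; rewrite X0.
exact: (card_supP setT (fun x => card_least (P x))).1.
Qed.

(** Nonemptiness of [S] settles the case of empty [X], where the supremum is 1 by convention. *)
Lemma sup_least_size_le {X : topologicalType} {P : X -> set (set X) -> Prop}
    {U : Type} {S : set U} : S !=set0 ->
  (forall x, exists2 N, P x N & N #<= S) -> sup_least_size P #<= S.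
Proof.
move=> S0 PS; rewrite /sup_least_size; case: asboolP => [_|_].
  by case: S0 => s Ss; apply: (card_le_injfun (fun=> s)) => // _ _ -> ->.
apply: card_sup_le => x _; have [N PN NS] := PS x.
by apply: card_le_trans NS; apply: (card_leastP _).2 => //; exists N.
Qed.

Lemma sup_least_size_neq0 {X : topologicalType} {P : X -> set (set X) -> Prop} :
  (forall x N, P x N -> N !=set0) -> (forall x, exists N, P x N) ->
  sup_least_size P !=set0.
Proof.
move=> P0 Pex; have [X0|/set0P[x _]] := eqVneq [set: X] set0.
  by rewrite /sup_least_size; case: asboolP => // _; exists set0.
have [N PN NS] := least_size_le_sup _ (Pex x).
exact: card_le_nonempty NS (P0 _ _ PN).
Qed.

Lemma sup_least_size_mono {X : topologicalType} {P Q : X -> set (set X) -> Prop} :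
  (forall x N, P x N -> N !=set0) -> (forall x, exists N, P x N) ->
  (forall x N, P x N -> Q x N) -> sup_least_size Q #<= sup_least_size P.
Proof.
move=> P0 Pex PQ; apply: sup_least_size_le (sup_least_size_neq0 P0 Pex) _ => x.
by have [N PN NS] := least_size_le_sup _ (Pex x); exists N => //; exact: PQ.
Qed.

(** * Counting unions and countable subsets *)

Lemma card_bigcup_le {I T U V : Type} {D : set I} {F : I -> set T}
    {K : set U} {S : set V} :
  D #<= K -> (forall i, D i -> F i #<= S) -> \bigcup_(i in D) F i #<= K `*` S.
Proof.
move=> DK FS; have [->|/set0P[t0 [i0 Di0 Ft0]]] := eqVneq (\bigcup_(i in D) F i) set0.
  exact: card_ge0.
have [v0 _] : S !=set0 by apply: card_le_nonempty (FS _ Di0) _; exists t0.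
have [u0 _] : K !=set0 by apply: card_le_nonempty DK _; exists i0.
have [k kK kinj] := card_le_exists_inj u0 DK.
have /choice[h hP] : forall i, exists f : T -> V, D i ->
    (forall t, F i t -> S (f t)) /\
    (forall t t', F i t -> F i t' -> f t = f t' -> t = t').
  move=> i; have [Di|nDi] := pselect (D i); last by exists (fun=> v0).
  by have [f fS finj] := card_le_exists_inj v0 (FS _ Di); exists f.
have /choice[c cP] : forall t, exists i, (\bigcup_(i in D) F i) t -> D i /\ F i t.
  move=> t; have [[i Di Fit]|nt] := pselect ((\bigcup_(i in D) F i) t).
    by exists i.
  by exists i0.
apply: (card_le_injfun (fun t => (k (c t), h (c t) t))) => [t /cP[Dc Fc]|].
  by split=> /=; [exact: kK|exact: (hP _ Dc).1].
move=> t t' /cP[Dc Fc] /cP[Dc' Fc'] [/(kinj _ _ Dc Dc') ct].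
by rewrite -ct in Fc' *; exact: (hP _ Dc).2.
Qed.

Lemma countable_subsets_le {T : Type} {A K : set T} :
  card_lt A K -> countable_subsets A #<= sequences_in K.
Proof.
move=> [AK nKA]; have [k0 Kk0] : K !=set0.
  by apply/set0P/eqP => K0; apply: nKA; rewrite K0.
have [i iK iinj] := card_le_exists_inj k0 AK.
(* Enumerating i(B) together with the point e outside i(A) also encodes B = set0. *)
have [e Ke ne] : exists2 e, K e & ~ (i @` A) e.
  apply: contrapT => /forall2NP nex; apply: nKA.
  apply: card_le_trans (card_image_le i A); apply: subset_card_le => e Ke.
  by have [|/contrapT] := nex e.
have /choice[f fP] : forall B, exists f : nat -> T, countable_subsets A B ->
    [set f n | n in setT] = e |` (i @` B).
  move=> B; have [[BA Bc]|nB] := pselect (countable_subsets A B); last first.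
    by exists (fun=> e).
  have [||f fE] := @card_le_exists_surj _ _ (e |` (i @` B)) [set: nat].
  - by exists e; left.
  - rewrite -bigcup2E; apply: bigcup_countable => [|[|[|n]] _ /=].
    + exact: countableP.
    + exact: countable1.
    + exact: card_le_trans (card_image_le _ _) Bc.
    + exact: countable0.
  - by exists f.
apply: (card_le_injfun f) => [B AB n|B B' AB AB' ff].
  have : (e |` (i @` B)) (f B n) by rewrite -(fP _ AB); exists n.
  by case=> [->//|[b Bb <-]]; apply/iK/(AB.1).
have E : e |` (i @` B) = e |` (i @` B') by rewrite -!fP// ff.
have sub C C' : countable_subsets A C -> countable_subsets A C' ->
    e |` (i @` C) = e |` (i @` C') -> C `<=` C'.
  move=> [CA _] [CA' _] CC b Cb; have : (e |` (i @` C')) (i b).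
    by rewrite -CC; right; exists b.
  case=> [ie|[b' C'b' /iinj <-]]; [|exact: C'b'|exact: CA'|exact: CA].
  by case: ne; exists b; [exact: CA|].
by apply/seteqP; split; apply: sub.
Qed.

(** A pair is coded by prepending its first component to the sequence coding the second. *)
Lemma setX_sequences_in {T V : Type} {K : set T} {S : set V} :
  S #<= sequences_in K -> K `*` S #<= sequences_in K.
Proof.
move=> SK; have [->|/set0P[[k0 _] _]] := eqVneq (K `*` S) set0.
  exact: card_ge0.
have [h hK hinj] := card_le_exists_inj (fun=> k0) SK.
apply: (card_le_injfun (fun (p : T * V) n => if n is m.+1 then h p.2 m else p.1)).
  by move=> [k s] [/= Kk Ss] [|n] //=; exact: hK.
move=> [k s] [k' s'] [/= Kk Ss] [/= Kk' Ss'] E.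
have kk : k = k' := congr1 (fun f => f 0) E.
suff -> : s = s' by rewrite kk.
by apply: hinj => //; apply/funext => n; exact: (congr1 (fun f => f n.+1) E).
Qed.

Lemma sup_countable_subsets_neq0 {T : Type} {K : set T} :
  K !=set0 -> sup_countable_subsets K !=set0.
Proof.
move=> K0; have : countable_subsets (@set0 T) #<= sup_countable_subsets K.
  apply: (card_supP [set A | card_lt A K] countable_subsets).1.
  by split=> // /card_le0P KE; rewrite KE in K0; case: K0.
by move=> /card_le_nonempty; apply; exists set0; split.
Qed.

(** * The cs-network from initial segments *)

Lemma cs_network_initial_segments {X : topologicalType} {x : X} {T : Type}
    {I : set T} {R : T -> T -> Prop} {g : T -> set X} :
  (forall a b, R a b \/ R b a) -> (forall a b c, R a b -> R b c -> R a c) ->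
  cs_star_network x (g @` I) ->
  cs_network x [set \bigcup_(a in C) g a | C in
    \bigcup_(a in I) countable_subsets [set b | I b /\ R b a]].
Proof.
move=> Rtot Rtrans gI U u xU ux.
pose W c := \bigcup_(b in [set b | [/\ I b, R b c & g b `<=` U]]) g b.
(* Once one segment covers almost all terms, one member per term suffices: a countable subfamily. *)
suff [c Ic [p _ Wp]] : exists2 c, I c & \forall n \near \oo, W c (u n).
  have /choice[b bP] : forall n, exists b,
      [/\ I b, R b c & g b `<=` U] /\ g b (u (p + n)).
    by move=> n; have [b ? ?] := Wp (p + n) (leq_addr _ _); exists b.
  exists (\bigcup_(a in range b) g a).
    exists (range b) => //; exists c => //; split=> [_ [n _ <-]|].
      by have [[]] := bP n.
    exact: card_image_le.
  split=> [y [_ [n _ <-]]|]; first by have [[_ _ gU] _] := bP n; exact: gU.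
  exists p => // n /= pn; exists (b (n - p)); first by exists (n - p).
  by have [_] := bP (n - p); rewrite subnKC.
apply: contrapT => /forall2NP nW.
have [m _ mP] : \forall n \near \oo,
    (\bigcup_(A in [set A | (g @` I) A /\ A `<=` U]) A) (u n).
  by apply: (cs_star_network_sb_network gI).1 ux; exists U.
have /choice[a aP] : forall n, exists a, [/\ I a, g a `<=` U & g a (u (m + n))].
  move=> n; have [_ [[a Ia <-] aU] ?] := mP (m + n) (leq_addr _ _).
  by exists a.
have freq c (Ic : I c) : ~ \forall n \near \oo, W c (u n) by case: (nW c).
have cof c : I c -> exists n, R c (a n).
  move=> Ic; apply: contrapT => /forallNP nR; apply: (freq c Ic).
  exists m => // n /= mn; have [Ia aU] := aP (n - m); rewrite subnKC// => an.
  by exists (a (n - m)) => //; split=> //; case: (Rtot c (a (n - m))) => // /nR.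
(* [M n] is a running maximum of [a 0], ..., [a n]. The diagonal subsequence below has its [n]-th
   term outside [W (M n)]. *)
have /choice[M MP] : forall n, exists c, I c /\ forall j, (j <= n)%N -> R (a j) c.
  elim=> [|n [c [Ic cmax]]].
    exists (a 0); split=> [|j]; first by case: (aP 0).
    by rewrite leqn0 => /eqP ->; case: (Rtot (a 0) (a 0)).
  have [ca|ac] := Rtot c (a n.+1).
    exists (a n.+1); split=> [|j]; first by case: (aP n.+1).
    rewrite leq_eqVlt => /predU1P[->|/cmax jc]; last exact: Rtrans jc ca.
    by case: (Rtot (a n.+1) (a n.+1)).
  by exists c; split=> // j; rewrite leq_eqVlt => /predU1P[->|/cmax].
have /choice[k kP] : forall n, exists l, (n <= l)%N /\ ~ W (M n) (u l).
  move=> n; have [l nl Wl] := not_near_infty_frequently (freq _ (MP n).1) n.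
  by exists l.
have vx : (u \o k) @ \oo --> x by apply: cvg_subseq ux => n; exact: (kP n).1.
have [_ [b Ib <-] [bU binf]] := gI _ _ xU vx.
(* From [j] on, [b] lies below [M n], so [g b] misses the diagonal terms, though it should contain
   infinitely many. *)
have [j Rbj] := cof _ Ib; have [n jn bn] := infinite_set_unbounded binf j.
apply: (kP n).2; exists b => //; split=> //.
exact: Rtrans Rbj ((MP n).2 _ jn).
Qed.

(** * The five assertions *)

Theorem proposition1 (X : topologicalType) (hX : accessible_space X) :
  [/\ [/\ cs_star_chi X #<= cs_chi X,
          cs_chi X #<= sb_chi X &
          sb_chi X #<= character X],
      frechet_urysohn X -> character X #= sb_chi X,
      [<-> finite_set (cs_star_chi X);
           finite_set (cs_chi X);
           finite_set (sb_chi X);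
           cs_star_chi X #= `I_1;
           cs_chi X #= `I_1;
           sb_chi X #= `I_1;
           convergent_sequences_trivial X],
      sb_chi X #<= subsets_of (cs_star_chi X) &
      cs_chi X #<= cs_star_chi X `*` sup_countable_subsets (cs_star_chi X) /\
      cs_star_chi X `*` sup_countable_subsets (cs_star_chi X)
        #<= sequences_in (cs_star_chi X)].
Proof.
have ex_base (x : X) : exists N, nbhs_base x N by exists (nbhs x); exact: nbhs_base_nbhs.
have ex_sb (x : X) : exists N, sb_network x N.
  by have [N] := ex_base x; exists N; exact: nbhs_base_sb_network.
have ex_cs (x : X) : exists N, cs_network x N.
  by have [N] := ex_sb x; exists N; exact: sb_network_cs_network.
have ex_cs_star (x : X) : exists N, cs_star_network x N.
  by have [N] := ex_cs x; exists N; exact: cs_network_cs_star_network.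
have cs_neq0 (x : X) N : cs_network x N -> N !=set0.
  by move=> /cs_network_cs_star_network/cs_star_network_neq0.
have sb_neq0 (x : X) N : sb_network x N -> N !=set0.
  by move=> /sb_network_cs_network/cs_neq0.
have base_neq0 (x : X) N : nbhs_base x N -> N !=set0.
  by move=> /nbhs_base_sb_network/sb_neq0.
have cs_star_chi0 : cs_star_chi X !=set0.
  exact: sup_least_size_neq0 (@cs_star_network_neq0 X) ex_cs_star.
have cs_chi0 : cs_chi X !=set0 := sup_least_size_neq0 cs_neq0 ex_cs.
have sb_chi0 : sb_chi X !=set0 := sup_least_size_neq0 sb_neq0 ex_sb.
have cs_star_cs : cs_star_chi X #<= cs_chi X.
  exact: sup_least_size_mono cs_neq0 ex_cs (@cs_network_cs_star_network X).
have cs_sb : cs_chi X #<= sb_chi X.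
  exact: sup_least_size_mono sb_neq0 ex_sb (@sb_network_cs_network X).
have sb_character : sb_chi X #<= character X.
  exact: sup_least_size_mono base_neq0 ex_base (@nbhs_base_sb_network X).
have finite_trivial : finite_set (cs_star_chi X) -> convergent_sequences_trivial X.
  move=> fin u x ux; exists x; have [N Nx NK] := least_size_le_sup _ (ex_cs_star x).
  exact: finite_cs_star_network_trivial (card_le_finite NK fin) Nx ux.
have trivial_sb1 : convergent_sequences_trivial X -> sb_chi X #<= `I_1.
  move=> triv; apply: sup_least_size_le; first by exists 0.
  move=> x; exists [set [set x]]; first exact: trivial_sb_network.
  by have := card_set1 (x := [set x]); rewrite card_eq_le => /andP[].
have finite1 n (T : Type) (A : set T) : A #= `I_n -> finite_set A by exists n.
have cs1 : finite_set (cs_star_chi X) -> cs_chi X #= `I_1.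
  move=> /finite_trivial/trivial_sb1/(card_le_trans cs_sb).
  exact: card_le1.
split=> //.
- move=> fu; apply: Cantor_Bernstein sb_character.
  apply: sup_least_size_mono sb_neq0 ex_sb _ => x N.
  exact: frechet_urysohn_nbhs_base.
(* Every arrow passes through triviality of convergent sequences; nonemptiness turns size at most 1
   into size 1. *)
- tfae.
  + by move=> /cs1/finite1.
  + move=> /(card_le_finite cs_star_cs)/finite_trivial/trivial_sb1.
    by move=> /(card_le1 sb_chi0)/finite1.
  + move=> /(card_le_finite cs_sb)/(card_le_finite cs_star_cs)/finite_trivial.
    move=> /trivial_sb1/(card_le_trans cs_sb)/(card_le_trans cs_star_cs).
    exact: card_le1.
  + by move=> /finite1/cs1.
  + move=> /finite1/(card_le_finite cs_star_cs)/finite_trivial/trivial_sb1.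
    exact: card_le1.
  + by move=> /finite1/(card_le_finite cs_sb)/(card_le_finite cs_star_cs).
  + move=> /trivial_sb1/(card_le_trans cs_sb)/(card_le_trans cs_star_cs).
    by move=> /(card_le1 cs_star_chi0)/finite1.
- apply: sup_least_size_le; first by exists set0.
  move=> x; have [N Nx NK] := least_size_le_sup _ (ex_cs_star x).
  eexists; first exact: cs_star_network_sb_network Nx.
  (* Each barrier is determined by the subfamily of [N] whose union it is; [i] carries subfamilies
     injectively to subsets of [cs_star_chi X]. *)
  have [i iK iinj] := card_le_exists_inj set0 NK.
  apply: (@card_le_trans _ _ _ [set M | M `<=` N]).
    apply: (@card_le_trans _ _ _ [set [set A | N A /\ A `<=` U] | U in nbhs x]).
      rewrite (_ : [set _ | U in _] = [set \bigcup_(A in M) A | M in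
          [set [set A | N A /\ A `<=` U] | U in nbhs x]]).
        exact: card_image_le.
      by rewrite image_comp.
    by apply: subset_card_le => _ [U _ <-] A [].
  apply: (card_le_injfun (fun M => i @` M)) => [M MN _ [A /MN NA <-]|M M' MN MN' E].
    exact: iK.
  have sub L L' : L `<=` N -> L' `<=` N -> i @` L = i @` L' -> L `<=` L'.
    move=> LN LN' LL A LA; have : (i @` L') (i A) by rewrite -LL; exists A.
    by move=> [A' L'A' /iinj <- //]; [exact: LN'|exact: LN].
  by apply/seteqP; split; apply: sub.
- split; last first.
    apply: setX_sequences_in; apply: card_sup_le => A; exact: countable_subsets_le.
  have [p Kp] : cs_star_chi X `*` sup_countable_subsets (cs_star_chi X) !=set0.
    have [a Ka] := cs_star_chi0; have [s Ss] := sup_countable_subsets_neq0 cs_star_chi0.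
    by exists (a, s).
  (* In the finite case [cs_chi X] is 1 and the nonempty product is at least 1; only the infinite
     case uses segments. *)
  have [fin|inf] := pselect (finite_set (cs_star_chi X)).
    rewrite (card_le_eql (cs1 fin)) -(card_le_eql (card_set1 (x := p))).
    by apply: subset_card_le => _ ->.
  have [I [R [IK Rtot Rtrans Rlt]]] := initial_well_order inf.
  apply: sup_least_size_le; first by exists p.
  move=> x; have [N Nx NK] := least_size_le_sup _ (ex_cs_star x).
  rewrite -(card_le_eqr IK) in NK.
  have [g gI] := card_le_exists_surj (cs_star_network_neq0 Nx) NK.
  rewrite -gI in Nx; eexists; first exact: cs_network_initial_segments Rtot Rtrans Nx.
  apply: card_le_trans (card_image_le _ _) _; apply: card_bigcup_le => [|a Ia].
    by move: IK; rewrite card_eq_le => /andP[].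
  exact: (card_supP [set A | card_lt A (cs_star_chi X)] countable_subsets).1 (Rlt _ Ia).
Qed.
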